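(* Let $p$ be a symmetric nc polynomial in $g$ symmetric variables, let $\mathcal O$ be an algebraically open set, and let $\mathcal S$ denote the set of full rank points $(X,v)$ of $p$ in $\mathcal V(p)\cap\mathcal O=\{(X,v): p(X)v=0 \text{ and } X\in\mathcal O\}$. Suppose that (i) there exists $(X,v)\in(\mathbb R^g\times\mathbb R)\cap\mathcal S$ (i.e. $\mathcal S$ contains a point with $n=1$); (ii) $\mathcal V(p)$ has positive curvature at each point of $\mathcal S$; and (iii) $p$ is a $0$-minimum degree defining polynomial for $\mathcal S$. Then the degree of $p$ is at most two and $p$ is concave.
   Context: Nc polynomials: $x=(x_1,\dots,x_g)$ are noncommuting indeterminates and $\mathbb R\langle x\rangle$ is the set of finite real linear combinations of words in $x$ (including the empty word); the degree is the maximal length of a word appearing nontrivially. The involution $T$ reverses words, with $x_j^T=x_j$ (the variables are ''symmetric''), and is extended linearly; $p$ is symmetric if $p^T=p$. For $X=(X_1,\dots,X_g)\in(\mathbb R^{n\times n}_{sym})^g$ (a $g$-tuple of real symmetric $n\times n$ matrices), $p(X)$ is the $n\times n$ matrix obtained by substitution, the constant term $c$ becoming $cI_n$. Derivatives: $p'(X)[H]=\frac{d}{dt}\big|_{t=0}p(X+tH)$ and $p''(X)[H]=\frac{d^2}{dt^2}\big|_{t=0}p(X+tH)$ for $X,H\in(\mathbb R^{n\times n}_{sym})^g$. Convexity: a symmetric $p$ is (matrix) convex if $p(tX+(1-t)Y)\preceq tp(X)+(1-t)p(Y)$ for all $n$, all $X,Y\in(\mathbb R^{n\times n}_{sym})^g$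 and $0\le t\le1$; it is concave if $-p$ is convex. Variety: $\mathcal V(p)=\bigcup_{n\ge1}\mathcal V_n(p)$, $\mathcal V_n(p)=\{(X,v)\in(\mathbb R^{n\times n}_{sym})^g\times\mathbb R^n: p(X)v=0\}$. Full rank point: $(X,v)\in\mathcal V_n(p)$ is a full rank point for $p$ if the linear map $(\mathbb R^{n\times n}_{sym})^g\ni H\mapsto p'(X)[H]v\in\mathbb R^n$ is onto. Positive curvature: $\mathcal V(p)$ has positive curvature at $(X,v)\in\mathcal V_n(p)$ if $-\langle p''(X)[H]v,v\rangle\ge0$ for every $H\in(\mathbb R^{n\times n}_{sym})^g$ with $p'(X)[H]v=0$. Algebraically open set: a set of the form $\bigcap_{q\in\mathcal Q}\{X: q(X)\succ0\}$ (with $X$ ranging over $g$-tuples of symmetric matrices of all sizes $n$), where $\mathcal Q$ is a finite set of symmetric nc polynomials. $0$-minimum degree defining polynomial: $p$ is a $0$-minimum degree defining polynomial for $\mathcal S\subseteq\mathcal V(p)$ if $\mathcal S\ne\emptyset$ and every nonzero (not necessarily symmetric) nc polynomial $q$ with $q(X)v=0$ for all $(X,v)\in\mathcal S$ satisfies $\deg q\ge\deg p$. *)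

(* Defs.v *)
From HB Require Import structures.
From mathcomp Require Import all_boot all_order all_algebra.
From mathcomp Require Import finmap.
From mathcomp.multinomials Require Import monalg.
From mathcomp Require Import boolp classical_sets reals topology normedtype derive.

Set Implicit Arguments.
Unset Strict Implicit.
Unset Printing Implicit Defensive.

Import Order.TTheory GRing.Theory Num.Theory.
Import numFieldNormedType.Exports.

Local Open Scope ring_scope.
Local Open Scope classical_set_scope.

(* R<x>: the monoid algebra over R of the free monoid of words in g letters. *)
Notation ncpoly R g := {malg R[{fmonom 'I_g}]}.

(* mmeasure is 1 + the maximal length of a word in the support, and 0 at p = 0,
   so both 0 and the nonzero constants get degree 0. *)
Definition ncdeg (R : realType) (g : nat) (p : ncpoly R g) : nat :=
  (mmeasure (@fdeg 'I_g) p).-1.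

Definition nctr (R : realType) (g : nat) (p : ncpoly R g) : ncpoly R g :=
  \sum_(w <- msupp p) << p@_w *g FMonom (rev w) >>.

Definition ncsymmetric (R : realType) (g : nat) (p : ncpoly R g) : Prop :=
  nctr p = p.

(* Matrix sizes n >= 1 are written n.+1 throughout: level n of a graded set
   consists of matrices of size n.+1. *)
Definition mxtuple (R : realType) (g n : nat) := 'I_g -> 'M[R]_n.+1.

Definition symtuple (R : realType) (g n : nat) (X : mxtuple R g n) : Prop :=
  forall i, X i \is symmetricmx.

Definition nceval (R : realType) (g n : nat) (p : ncpoly R g)
    (X : mxtuple R g n) : 'M[R]_n.+1 :=
  mmap (fun c : R => c%:M) (fun w : {fmonom 'I_g} => \prod_(i <- w) X i) p.

Definition ncline (R : realType) (g n : nat) (p : ncpoly R g)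
    (X H : mxtuple R g n) (t : R) : 'M[R]_n.+1 :=
  nceval p (fun i => X i + t *: H i).

Definition ncderiv (R : realType) (g n : nat) (p : ncpoly R g)
    (X H : mxtuple R g n) : 'M[R]_n.+1 :=
  derive1n 1 (ncline p X H) 0.

Definition ncderiv2 (R : realType) (g n : nat) (p : ncpoly R g)
    (X H : mxtuple R g n) : 'M[R]_n.+1 :=
  derive1n 2 (ncline p X H) 0.

Definition inner (R : realType) (m : nat) (u v : 'cV[R]_m) : R :=
  (u^T *m v) 0 0.

Definition psdmx (R : realType) (m : nat) (A : 'M[R]_m) : Prop :=
  A \is symmetricmx /\ forall v : 'cV[R]_m, 0 <= inner (A *m v) v.

Definition pdmx (R : realType) (m : nat) (A : 'M[R]_m) : Prop :=
  A \is symmetricmx /\ forall v : 'cV[R]_m, v != 0 -> 0 < inner (A *m v) v.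

Definition ncconvex (R : realType) (g : nat) (p : ncpoly R g) : Prop :=
  forall (n : nat) (X Y : mxtuple R g n) (t : R),
    symtuple X -> symtuple Y -> 0 <= t <= 1 ->
    psdmx (t *: nceval p X + (1 - t) *: nceval p Y
           - nceval p (fun i => t *: X i + (1 - t) *: Y i)).

Definition ncconcave (R : realType) (g : nat) (p : ncpoly R g) : Prop :=
  ncconvex (- p).

Definition variety (R : realType) (g : nat) (p : ncpoly R g) (n : nat) :
    set (mxtuple R g n * 'cV[R]_n.+1) :=
  [set Xv | symtuple Xv.1 /\ nceval p Xv.1 *m Xv.2 = 0].

Arguments variety {R g} p n _.

Definition full_rank (R : realType) (g n : nat) (p : ncpoly R g)
    (X : mxtuple R g n) (v : 'cV[R]_n.+1) : Prop :=
  forall w : 'cV[R]_n.+1,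
    exists2 H : mxtuple R g n, symtuple H & ncderiv p X H *m v = w.

Definition positive_curvature (R : realType) (g n : nat) (p : ncpoly R g)
    (X : mxtuple R g n) (v : 'cV[R]_n.+1) : Prop :=
  forall H : mxtuple R g n, symtuple H -> ncderiv p X H *m v = 0 ->
    0 <= - inner (ncderiv2 p X H *m v) v.

Definition algebraically_open (R : realType) (g : nat)
    (O : forall n, set (mxtuple R g n)) : Prop :=
  exists2 Q : seq (ncpoly R g), (forall q, q \in Q -> ncsymmetric q) &
    forall n, O n =
      [set X | symtuple X /\ forall q, q \in Q -> pdmx (nceval q X)].

Definition full_rank_set (R : realType) (g : nat) (p : ncpoly R g)
    (O : forall n, set (mxtuple R g n)) (n : nat) :
    set (mxtuple R g n * 'cV[R]_n.+1) :=
  [set Xv | [/\ variety p n Xv, O n Xv.1 & full_rank p Xv.1 Xv.2]].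

Arguments full_rank_set {R g} p O n _.

Definition zero_min_degree_defining (R : realType) (g : nat) (p : ncpoly R g)
    (S : forall n, set (mxtuple R g n * 'cV[R]_n.+1)) : Prop :=
  [/\ forall n, S n `<=` variety p n,
      exists n, S n !=set0 &
      forall q : ncpoly R g, q != 0 ->
        (forall n (X : mxtuple R g n) (v : 'cV[R]_n.+1),
           S n (X, v) -> nceval q X *m v = 0) ->
        (ncdeg p <= ncdeg q)%N].

(* Main.v *)
(* Let d = deg p, p_w be the coefficient of the word w in p, and (+) denote direct
   sums. Full rank points in O are closed under direct sums, so minimality of the
   degree yields one point (X,v) at which the vectors w(X)v, |w| < d, are
   linearly independent. At (X (+) X, v (+) v) the vectors H_j w(X)v can then be
   prescribed freely in the antidiagonal {y (+) -y}. Those with |w| = d-1 do not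
   occur in p''(X)[H] and suffice to solve p'(X)[H]v = 0, so positive curvature
   makes the form -<p''(X)[H]v,v> nonnegative in all the other ones. If d >= 3
   and w = x_j x_i c is a word of p with |c| = d-2, then H_i c(X)v enters this
   form only linearly, with coefficient 2 p_w against H_j v, which is absurd.
   If d <= 2, the form is governed by the matrix of the coefficients of x_i x_j,
   which is therefore negative semidefinite; this is concavity of p. *)
Require Import Defs.
From mathcomp Require Import all_boot all_order all_algebra.
From mathcomp Require Import finmap.
From mathcomp.multinomials Require Import monalg.
From mathcomp Require Import boolp classical_sets functions reals.
From mathcomp Require Import topology normedtype derive.
From mathcomp Require Import ring lra zify.

Set Implicit Arguments.
Unset Strict Implicit.
Unset Printing Implicit Defensive.

Import Order.TTheory GRing.Theory Num.Theory.
Import numFieldNormedType.Exports.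

Local Open Scope ring_scope.

(** * Symmetric matrices and the standard inner product *)

Lemma symmetricmxP (R : realType) n (A : 'M[R]_n) :
  reflect (A^T = A) (A \is symmetricmx).
Proof.
apply: (iffP idP) => [/is_hermitianmxP | AT].
  by rewrite expr0 scale1r map_mx_id.
by apply/is_hermitianmxP; rewrite expr0 scale1r map_mx_id.
Qed.

Section Inner.
Variables (R : realType) (m : nat).
Implicit Types (u v w : 'cV[R]_m) (A : 'M[R]_m).

Lemma innerE u v : inner u v = \sum_k u k 0 * v k 0.
Proof. by rewrite /inner mxE; apply: eq_bigr => k _; rewrite mxE. Qed.

Lemma inner0l v : inner 0 v = 0.
Proof. by rewrite innerE big1 // => k _; rewrite mxE mul0r. Qed.

Lemma innerC u v : inner u v = inner v u.
Proof. by rewrite !innerE; apply: eq_bigr => k _; rewrite mulrC. Qed.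

Lemma innerDl u v w : inner (u + v) w = inner u w + inner v w.
Proof. by rewrite /inner linearD mulmxDl mxE. Qed.

Lemma innerZl a u v : inner (a *: u) v = a * inner u v.
Proof. by rewrite /inner linearZ /= -scalemxAl mxE. Qed.

Lemma innerNl u v : inner (- u) v = - inner u v.
Proof. by rewrite -scaleN1r innerZl mulN1r. Qed.

Lemma innerDr u v w : inner u (v + w) = inner u v + inner u w.
Proof. by rewrite innerC innerDl !(innerC _ u). Qed.

Lemma innerZr a u v : inner u (a *: v) = a * inner u v.
Proof. by rewrite innerC innerZl innerC. Qed.

Lemma innerNr u v : inner u (- v) = - inner u v.
Proof. by rewrite innerC innerNl innerC. Qed.

Lemma inner0r v : inner v 0 = 0.
Proof. by rewrite innerC inner0l. Qed.

Lemma inner_suml I (r : seq I) (F : I -> 'cV[R]_m) v :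
  inner (\sum_(i <- r) F i) v = \sum_(i <- r) inner (F i) v.
Proof.
by apply: (big_morph (fun u => inner u v)) => [x y|]; rewrite ?innerDl ?inner0l.
Qed.

Lemma inner_mulmx A u v : inner (A *m u) v = inner u (A^T *m v).
Proof. by rewrite /inner trmx_mul mulmxA. Qed.

Lemma inner_gt0 v : v != 0 -> 0 < inner v v.
Proof.
move=> v0; rewrite innerE lt0r sumr_ge0 => [|k _]; last exact: sqr_ge0.
rewrite andbT; apply: contraNneq v0 => /eqP.
rewrite psumr_eq0 => [/allP v0|k _]; last exact: sqr_ge0.
apply/eqP/matrixP => i j; rewrite ord1 mxE; apply/eqP.
by have := v0 i (mem_index_enum i); rewrite mulf_eq0 orbb.
Qed.

End Inner.

Lemma inner_const1_gt0 (R : realType) n :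
  0 < inner (const_mx 1 : 'cV[R]_n.+1) (const_mx 1).
Proof.
apply: inner_gt0; apply/eqP => /matrixP /(_ 0 0); rewrite !mxE.
by apply/eqP; exact: oner_neq0.
Qed.

Lemma inner_col_mx (R : realType) m n (u1 v1 : 'cV[R]_m) (u2 v2 : 'cV[R]_n) :
  inner (col_mx u1 u2) (col_mx v1 v2) = inner u1 v1 + inner u2 v2.
Proof. by rewrite /inner tr_col_mx mul_row_col mxE. Qed.

(** * Derivatives of matrix products and of words *)

Lemma is_derive_mulmx (R : realType) m n q (A A' : R -> 'M[R]_(m.+1, n.+1))
    (B B' : R -> 'M[R]_(n.+1, q.+1)) (t : R) :
  is_derive t 1 A (A' t) -> is_derive t 1 B (B' t) ->
  is_derive t 1 (fun s => A s *m B s) (A' t *m B t + A t *m B' t).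
Proof.
move=> dA dB.
have dAij i j : is_derive t 1 (fun s => A s i j) (A' t i j).
  have [dAt <-] := dA; rewrite derive_mx // mxE; apply: derivableP.
  by move: i j; apply/derivable_mxP.
have dBij i j : is_derive t 1 (fun s => B s i j) (B' t i j).
  have [dBt <-] := dB; rewrite derive_mx // mxE; apply: derivableP.
  by move: i j; apply/derivable_mxP.
have dABij i j : is_derive t 1 (fun s => (A s *m B s) i j)
    ((A' t *m B t + A t *m B' t) i j).
  have -> : (fun s => (A s *m B s) i j) =
      \sum_k (((fun s => A s i k) : R -> R) * ((fun s => B s k j) : R -> R)).
    by apply/funext => s; rewrite mxE fct_sumE.
  apply: is_derive_eq; rewrite !mxE -big_split /=.
  apply: eq_bigr => k _; rewrite addrC; congr (_ + _).
  by rewrite [LHS]mulrC.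
have dAB : derivable (fun s => A s *m B s) t 1.
  by apply/derivable_mxP => i j; have [] := dABij i j.
apply: DeriveDef => //; rewrite derive_mx //; apply/matrixP => i j.
by rewrite mxE; have [] := dABij i j.
Qed.

Lemma is_derive_lincomb (R : realType) (V : normedModType R) (I : Type)
    (r : seq I) (c : I -> R) (F F' : I -> R -> V) (t : R) :
  (forall i, is_derive t 1 (F i) (F' i t)) ->
  is_derive t 1 (fun s => \sum_(i <- r) c i *: F i s)
    (\sum_(i <- r) c i *: F' i t).
Proof.
move=> dF; elim: r => [|i r IHr].
  have -> : (fun s => \sum_(i <- [::]) c i *: F i s) = cst 0.
    by apply/funext => s; rewrite big_nil.
  by rewrite big_nil; exact: is_derive_cst.
have -> : (fun s => \sum_(i <- i :: r) c i *: F i s) =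
    (c i \*: F i) + (fun s => \sum_(i <- r) c i *: F i s).
  by apply/funext => s; rewrite big_cons.
by rewrite big_cons; apply: is_deriveD.
Qed.

Section WordDerivatives.
Variables (R : realType) (g n : nat).
Implicit Types (X H : mxtuple R g n) (w : seq 'I_g) (v : 'cV[R]_n.+1).

Definition wmx X w : 'M[R]_n.+1 := \prod_(i <- w) X i.

Fixpoint dwmx X H w : 'M[R]_n.+1 :=
  if w is i :: u then H i *m wmx X u + X i *m dwmx X H u else 0.

(* Half the second derivative of [wmx] in the direction [H]. *)
Fixpoint ddwmx X H w : 'M[R]_n.+1 :=
  if w is i :: u then H i *m dwmx X H u + X i *m ddwmx X H u else 0.

Lemma wmx_nil X : wmx X [::] = 1%:M.
Proof. by rewrite /wmx big_nil. Qed.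

Lemma wmx_cons X i w : wmx X (i :: w) = X i *m wmx X w.
Proof. by rewrite /wmx big_cons. Qed.

Lemma ncevalE (p : ncpoly R g) X :
  nceval p X = \sum_(w <- msupp p) p@_w *: wmx X w.
Proof. by apply: eq_bigr => w _; rewrite -mul_scalar_mx. Qed.

Let line X H t : mxtuple R g n := fun i => X i + t *: H i.

Lemma is_derive_line X H i (t : R) :
  is_derive t 1 (fun s => line X H s i) (H i).
Proof.
have dH : is_derive t 1 (fun s : R => s *: H i) (H i).
  have df := is_diff_scalel t (H i).
  have sd : derivable (fun s : R => s *: H i) t 1.
    by apply: diff_derivable; have [] := df.
  apply: DeriveDef => //; rewrite deriveE; last by have [] := df.
  by rewrite diff_val scale1r.
have -> : (fun s => line X H s i) = cst (X i) + (fun s : R => s *: H i) by [].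
have := is_deriveD (is_derive_cst (X i) t 1) dH; move/is_derive_eq; apply.
by rewrite add0r.
Qed.

Lemma is_derive_wmx X H w (t : R) :
  is_derive t 1 (fun s => wmx (line X H s) w) (dwmx (line X H t) H w).
Proof.
elim: w => [|i w IHw].
  have -> : (fun s => wmx (line X H s) [::]) = cst 1%:M.
    by apply/funext => s; rewrite wmx_nil.
  exact: is_derive_cst.
have -> : (fun s => wmx (line X H s) (i :: w)) =
    fun s => line X H s i *m wmx (line X H s) w.
  by apply/funext => s; rewrite wmx_cons.
exact: (is_derive_mulmx (A' := cst (H i))
          (B' := fun s => dwmx (line X H s) H w) (is_derive_line X H i t)).
Qed.

(** In the Leibniz expansion [H i *m dwmx] arises twice, from [H i *m wmx] and from [X i *m dwmx];
    this is the factor 2. *)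
Lemma is_derive_dwmx X H w (t : R) :
  is_derive t 1 (fun s => dwmx (line X H s) H w)
    (2 *: ddwmx (line X H t) H w).
Proof.
elim: w => [|i w IHw].
  by rewrite scaler0; exact: is_derive_cst.
have d1 := is_derive_mulmx (A := cst (H i)) (A' := cst 0)
  (B' := fun s => dwmx (line X H s) H w) (is_derive_cst _ _ _)
  (is_derive_wmx X H w t).
have d2 := is_derive_mulmx (A' := cst (H i))
  (B' := fun s => 2 *: ddwmx (line X H s) H w) (is_derive_line X H i t) IHw.
have := is_deriveD d1 d2; move/is_derive_eq; apply => /=.
rewrite mul0mx add0r addrA scalerDr -scalemxAr; congr (_ + _).
by rewrite scaler_nat mulr2n.
Qed.

Lemma line0 X H : line X H 0 = X.
Proof. by apply/funext => i; rewrite /line scale0r addr0. Qed.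

Lemma ncline_deriv (p : ncpoly R g) X H :
  derive1 (ncline p X H) =
  fun t => \sum_(w <- msupp p) p@_w *: dwmx (line X H t) H w.
Proof.
apply/funext => t; rewrite derive1E.
have -> : ncline p X H =
    fun s => \sum_(w <- msupp p) p@_w *: wmx (line X H s) w.
  by apply/funext => s; rewrite /ncline ncevalE.
have [] // := is_derive_lincomb
  (F := fun (w : {fmonom 'I_g}) s => wmx (line X H s) w)
  (F' := fun (w : {fmonom 'I_g}) s => dwmx (line X H s) H w)
  (msupp p) (mcoeff^~ p) (t := t).
by move=> w; exact: is_derive_wmx.
Qed.

Lemma ncderivE (p : ncpoly R g) X H :
  ncderiv p X H = \sum_(w <- msupp p) p@_w *: dwmx X H w.
Proof. by rewrite /ncderiv derive1n1 ncline_deriv line0. Qed.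

Lemma ncderiv2E (p : ncpoly R g) X H :
  ncderiv2 p X H = 2 *: \sum_(w <- msupp p) p@_w *: ddwmx X H w.
Proof.
rewrite /ncderiv2 derive1nS derive1n1 ncline_deriv derive1E.
have [] // := is_derive_lincomb
  (F := fun (w : {fmonom 'I_g}) s => dwmx (line X H s) H w)
  (F' := fun (w : {fmonom 'I_g}) s => 2 *: ddwmx (line X H s) H w)
  (msupp p) (mcoeff^~ p)
  (t := 0).
  by move=> w; exact: is_derive_dwmx.
move=> _ ->; rewrite line0 scaler_sumr; apply: eq_bigr => w _.
by rewrite !scalerA mulrC.
Qed.

End WordDerivatives.

(** * Derivatives of words in terms of border vectors *)

Section Border.
Variables (R : realType) (g n : nat).
Implicit Types (X H : mxtuple R g n) (w b c u : seq 'I_g) (v : 'cV[R]_n.+1).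
Implicit Types (Y Z : 'I_g -> seq 'I_g -> 'cV[R]_n.+1).

(* [border X Y w] and [hess X Y Y b w] are the first and half the second
   derivative of the word [w], the latter paired with [b(X) v], written in terms
   of the vectors [Y j u = H_j u(X) v] alone. *)
Fixpoint border X Y w : 'cV[R]_n.+1 :=
  if w is i :: u then Y i u + X i *m border X Y u else 0.

Fixpoint hess X Y Z b w : R :=
  if w is i :: u then inner (border X Y u) (Z i b) + hess X Y Z (i :: b) u
  else 0.

(** Each occurrence of [H j] acts on a proper suffix of [w], so lengths below [d] suffice for words
    of length [d]. *)
Lemma dwmx_border X H Y v d w :
    (forall j u, (size u < d)%N -> H j *m (wmx X u *m v) = Y j u) ->
  (size w <= d)%N -> dwmx X H w *m v = border X Y w.
Proof.
move=> HY; elim: w => [|i w IHw] /= wd; first by rewrite mul0mx.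
by rewrite mulmxDl -!mulmxA HY // IHw // ltnW.
Qed.

(** Symmetry moves the leading letter across the inner product: [X i] turns [b] into [i :: b], and
    [H i] yields [Y i b]. Thus [b] accumulates the reverse of the prefix already read. *)
Lemma ddwmx_hess X H Y v d b w :
    symtuple X -> symtuple H ->
    (forall j u, (size u < d)%N -> H j *m (wmx X u *m v) = Y j u) ->
    (size b + size w <= d)%N ->
  inner (ddwmx X H w *m v) (wmx X b *m v) = hess X Y Y b w.
Proof.
move=> symX symH HY; elim: w b => [|i w IHw] b /= bwd.
  by rewrite mul0mx inner0l.
rewrite mulmxDl -!mulmxA innerDl (inner_mulmx (H i)) (inner_mulmx (X i)).
rewrite (elimT (symmetricmxP _) (symH i)) (elimT (symmetricmxP _) (symX i)).
rewrite HY; last by lia.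
rewrite (dwmx_border HY); last by lia.
by rewrite mulmxA -wmx_cons IHw //=; lia.
Qed.

Lemma eq_border X Y Z e w :
    (forall j u, (size u < e)%N -> Y j u = Z j u) -> (size w <= e)%N ->
  border X Y w = border X Z w.
Proof.
move=> YZ; elim: w => //= i w IHw we.
by rewrite YZ // IHw // ltnW.
Qed.

(* A border vector whose word has length [e] is paired only with the derivative
   of the empty word, which is zero. *)
Lemma eq_hess X Y Z e b w :
    (forall j u, (size u < e)%N -> Y j u = Z j u) ->
    (size b + size w <= e.+1)%N ->
  hess X Y Y b w = hess X Z Z b w.
Proof.
move=> YZ; elim: w b => //= i w IHw b bwe.
rewrite IHw /=; last by lia.
congr (_ + _); rewrite (eq_border X YZ); last by lia.
have [be|be] := ltnP (size b) e; first by rewrite YZ.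
by have -> : w = [::]; [apply: size0nil; lia|rewrite !inner0l].
Qed.

Lemma borderD X Y Z w :
  border X (fun j u => Y j u + Z j u) w = border X Y w + border X Z w.
Proof.
elim: w => [|i w IHw] /=; first by rewrite addr0.
by rewrite IHw mulmxDr addrACA.
Qed.

Lemma borderZ X Y a w :
  border X (fun j u => a *: Y j u) w = a *: border X Y w.
Proof.
elim: w => [|i w IHw] /=; first by rewrite scaler0.
by rewrite IHw -scalemxAr scalerDr.
Qed.

Lemma hess_quadratic X Y Z a b w :
  let YZ := fun j u => a *: Y j u + Z j u in
  hess X YZ YZ b w = a ^+ 2 * hess X Y Y b w
    + a * (hess X Y Z b w + hess X Z Y b w) + hess X Z Z b w.
Proof.
elim: w b => [|i w IHw] b /=; first by ring.
rewrite IHw borderD borderZ !(innerDl, innerDr, innerZl, innerZr); ring.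
Qed.

Definition single (k : 'I_g) c v j u : 'cV[R]_n.+1 :=
  if (j == k) && (u == c) then v else 0.

(** Only a suffix [k :: c] contributes, and the length bound forces it to be all of [w], so no
    factor [X] remains in front. *)
Lemma border_single X k c v w : (size w <= (size c).+1)%N ->
  border X (single k c v) w = if w == k :: c then v else 0.
Proof.
elim: w => //= i w IHw wc.
rewrite IHw; last by rewrite ltnW.
have /negPf -> : w != k :: c.
  by apply: contraTneq wc => ->; rewrite /= ltnn.
by rewrite mulmx0 addr0 eqseq_cons.
Qed.

(** The second family is evaluated only at extensions of [b], all longer than [c]. *)
Lemma hess_single0 X Y k c v b w : (size c < size b)%N ->
  hess X Y (single k c v) b w = 0.
Proof.
elim: w b => //= i w IHw b cb.
rewrite IHw; last by rewrite ltnW.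
have /negPf bc : b != c by apply: contraTneq cb => ->; rewrite ltnn.
by rewrite /single bc andbF inner0r addr0.
Qed.

Lemma hess_single_short X Y k c v b w : (size b + size w <= size c)%N ->
  hess X Y (single k c v) b w = 0.
Proof.
elim: w b => //= i w IHw b cb.
rewrite IHw /=; last by lia.
have /negPf bc : b != c by apply: contraTneq cb => ->; rewrite -ltnNge; lia.
by rewrite /single bc andbF inner0r addr0.
Qed.

(** The accumulated prefix has the length of [c] exactly when the letter [i] is read, so one term
    survives. *)
Lemma hess_single_cat X Y k c v b a i u : (size b + size a = size c)%N ->
  hess X Y (single k c v) b (a ++ i :: u) =
  if (i == k) && (catrev a b == c) then inner (border X Y u) v else 0.
Proof.
elim: a b => [|j a IHa] b /= bac.
  rewrite hess_single0 /=; last by lia.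
  by rewrite addr0 /single; case: ifP => // _; rewrite inner0r.
rewrite IHa /=; last by lia.
have /negPf bc : b != c by apply/eqP => bc; move: bac; rewrite bc; lia.
by rewrite {1}/single bc andbF inner0r add0r.
Qed.

(** In the second slot, [B] selects the first letter of [w] and [A] the letter after [size c]
    others; the length bound then determines the rest of [w]. *)
Lemma hess_singles X i j c v w : (0 < size c)%N ->
    (size w <= (size c).+2)%N ->
  let A := single i c v in let B := single j [::] v in
  [/\ hess X A A [::] w = 0,
      hess X A B [::] w = (w == [:: j, i & c])%:R * inner v v &
      hess X B A [::] w = (w == rev [:: j, i & c])%:R * inner v v].
Proof.
move=> c0 wc A B.
have revc : rev [:: j, i & c] = rev c ++ [:: i; j].
  by rewrite !rev_cons -!cats1 -catA.
have hAB : hess X A B [::] w = (w == [:: j, i & c])%:R * inner v v.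
  case: w wc => [_|k u] /=; first by rewrite mul0r.
  move=> uc; rewrite hess_single0 // addr0 /B /single eqxx andbT.
  rewrite border_single //.
  rewrite eqseq_cons; case: (k == j) => /=; last by rewrite inner0r mul0r.
  by case: eqP => _; rewrite ?mul1r // inner0l mul0r.
have [wc'|wc'] := leqP (size w) (size c).
  rewrite hAB !hess_single_short // revc; split=> //.
  have /negPf -> : w != rev c ++ [:: i; j]; last by rewrite mul0r.
  by apply: contraTneq wc' => ->; rewrite size_cat size_rev /= addn2 -ltnNge.
(* With [A] in the second slot only the cut after [size c] letters counts; beyond the letter [k]
   read there, the remainder [u] has at most one letter. *)
have := cat_take_drop (size c) w.
have := size_takel (ltnW wc').
move: (take _ w) (size_drop (size c) w) => a.
case: (drop _ w) => [|k u] /= su ac Ew; first by lia.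
rewrite hAB -Ew !hess_single_cat // !border_single /=; try lia.
(* Here [0 < size c] enters: [u] has at most one letter, [i :: c] at least two. *)
have -> : (u == i :: c) = false.
  by apply: contraTF c0 => /eqP uic; move: su; rewrite uic /=; lia.
split=> //; first by rewrite inner0l if_same.
rewrite revc eqseq_cat ?size_rev // eqseq_cons catrevE cats0.
rewrite -(inj_eq (can_inj revK) a) revK andbC.
case: (_ == c); case: (k == i) => //=; rewrite ?mul0r //.
by case: eqP; rewrite ?inner0l ?mul0r ?mul1r.
Qed.

End Border.

(** * Two-by-two block matrices and block columns *)

(* [block_mx] and [col_mx] at the literal dimension [(n + m.+1).+1], which is only
   convertible to the [n.+1 + m.+1] that rewriting would look for. *)
Section SquareBlocks.
Variables (R : realType) (n m : nat).
Implicit Types (u v : 'cV[R]_n.+1) (w z : 'cV[R]_m.+1).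

Definition sqblock A B C D : 'M[R]_((n + m.+1).+1) :=
  @block_mx R n.+1 m.+1 n.+1 m.+1 A B C D.

Definition sqcol u w : 'cV[R]_((n + m.+1).+1) := @col_mx R n.+1 m.+1 1 u w.

Lemma sqcolP x : exists u w, x = sqcol u w.
Proof.
by exists (@usubmx R n.+1 m.+1 1 x), (@dsubmx R n.+1 m.+1 1 x);
  rewrite /sqcol vsubmxK.
Qed.

Lemma sqcol_eq0 u w : (sqcol u w == 0) = (u == 0) && (w == 0).
Proof. exact: (@col_mx_eq0 R n.+1 m.+1 1). Qed.

Lemma sqcolD u v w z : sqcol u w + sqcol v z = sqcol (u + v) (w + z).
Proof. exact: (@add_col_mx R n.+1 m.+1 1). Qed.

Lemma sqcolZ a u w : a *: sqcol u w = sqcol (a *: u) (a *: w).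
Proof. exact: (@scale_col_mx R n.+1 m.+1 1). Qed.

Lemma sqcol_sum (I : Type) (r : seq I) (c : I -> R) F G :
  \sum_(i <- r) c i *: sqcol (F i) (G i) =
  sqcol (\sum_(i <- r) c i *: F i) (\sum_(i <- r) c i *: G i).
Proof.
elim: r => [|i r IHr]; last by rewrite !big_cons IHr sqcolZ sqcolD.
by rewrite !big_nil; symmetry; apply/eqP; rewrite sqcol_eq0 !eqxx.
Qed.

Lemma inner_sqcol u v w z :
  inner (sqcol u w) (sqcol v z) = inner u v + inner w z.
Proof. exact: (@inner_col_mx R n.+1 m.+1). Qed.

Lemma tr_sqblock A B C D : (sqblock A B C D)^T = sqblock A^T C^T B^T D^T.
Proof. exact: (@tr_block_mx R n.+1 m.+1 n.+1 m.+1). Qed.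

Lemma sqblock_col A B C D u w :
  sqblock A B C D *m sqcol u w = sqcol (A *m u + B *m w) (C *m u + D *m w).
Proof. exact: (@mul_block_col R n.+1 m.+1 n.+1 m.+1). Qed.

Lemma sqblockD A B C D A' B' C' D' :
  sqblock A B C D + sqblock A' B' C' D' =
  sqblock (A + A') (B + B') (C + C') (D + D').
Proof. exact: (@add_block_mx R n.+1 m.+1 n.+1 m.+1). Qed.

Lemma sqblockZ a A B C D :
  a *: sqblock A B C D = sqblock (a *: A) (a *: B) (a *: C) (a *: D).
Proof. exact: (@scale_block_mx R n.+1 m.+1 n.+1 m.+1). Qed.

Definition sqdiag A D := sqblock A 0 0 D.

Lemma sqdiag0 : sqdiag 0 0 = 0.
Proof. exact: (@block_mx0 R n.+1 m.+1 n.+1 m.+1). Qed.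

Lemma sqdiag1 : sqdiag 1%:M 1%:M = 1%:M.
Proof. by symmetry; exact: (@scalar_mx_block R n.+1 m.+1). Qed.

Lemma sqdiagD A D A' D' : sqdiag A D + sqdiag A' D' = sqdiag (A + A') (D + D').
Proof. by rewrite /sqdiag sqblockD !addr0. Qed.

Lemma sqdiagZ a A D : a *: sqdiag A D = sqdiag (a *: A) (a *: D).
Proof. by rewrite /sqdiag sqblockZ !scaler0. Qed.

Lemma sqdiagM A D A' D' :
  sqdiag A D *m sqdiag A' D' = sqdiag (A *m A') (D *m D').
Proof.
have := @mulmx_block R n.+1 m.+1 n.+1 m.+1 n.+1 m.+1 A 0 0 D A' 0 0 D'.
by rewrite !(mulmx0, mul0mx) !addr0 !add0r.
Qed.

Lemma sqdiag_col A D u w : sqdiag A D *m sqcol u w = sqcol (A *m u) (D *m w).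
Proof. by rewrite sqblock_col !mul0mx addr0 add0r. Qed.

Lemma sqdiag_sym A D :
  A \is symmetricmx -> D \is symmetricmx -> sqdiag A D \is symmetricmx.
Proof.
move=> /symmetricmxP symA /symmetricmxP symD; apply/symmetricmxP.
by rewrite tr_sqblock !trmx0 symA symD.
Qed.

Lemma sqdiag_sum (I : Type) (r : seq I) (c : I -> R) F G :
  \sum_(i <- r) c i *: sqdiag (F i) (G i) =
  sqdiag (\sum_(i <- r) c i *: F i) (\sum_(i <- r) c i *: G i).
Proof.
elim: r => [|i r IHr]; first by rewrite !big_nil sqdiag0.
by rewrite !big_cons IHr sqdiagZ sqdiagD.
Qed.

Lemma pdmx_sqdiag A D : pdmx A -> pdmx D -> pdmx (sqdiag A D).
Proof.
move=> [symA posA] [symD posD]; split; first exact: sqdiag_sym.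
move=> x; have [u [w ->]] := sqcolP x.
rewrite sqdiag_col inner_sqcol sqcol_eq0 negb_and.
have nneg k (C : 'M[R]_k) (y : 'cV_k) :
    (y != 0 -> 0 < inner (C *m y) y) -> 0 <= inner (C *m y) y.
  by have [-> _|_ /(_ isT) /ltW //] := eqVneq y 0; rewrite inner0r.
case/orP => nz.
  by apply: ltr_wpDr; [apply: nneg; exact: posD|exact: posA].
by apply: ltr_wpDl; [apply: nneg; exact: posA|exact: posD].
Qed.

End SquareBlocks.

(** * Direct sums of points *)

Section DirectSum.
Variables (R : realType) (g n m : nat).
Implicit Types (X H : mxtuple R g n) (Y K : mxtuple R g m).

Definition dsum X Y : mxtuple R g (n + m.+1) := fun i => sqdiag (X i) (Y i).

Lemma symtuple_dsum X Y : symtuple X -> symtuple Y -> symtuple (dsum X Y).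
Proof. by move=> symX symY i; exact: sqdiag_sym. Qed.

Lemma wmx_dsum X Y w : wmx (dsum X Y) w = sqdiag (wmx X w) (wmx Y w).
Proof.
elim: w => [|i w IHw]; first by rewrite !wmx_nil sqdiag1.
by rewrite !wmx_cons IHw sqdiagM.
Qed.

Lemma dwmx_dsum X Y H K w :
  dwmx (dsum X Y) (dsum H K) w = sqdiag (dwmx X H w) (dwmx Y K w).
Proof.
elim: w => [|i w IHw] /=; first by rewrite sqdiag0.
by rewrite IHw wmx_dsum !sqdiagM sqdiagD.
Qed.

Lemma nceval_dsum (p : ncpoly R g) X Y :
  nceval p (dsum X Y) = sqdiag (nceval p X) (nceval p Y).
Proof.
by rewrite !ncevalE -sqdiag_sum; apply: eq_bigr => w _; rewrite wmx_dsum.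
Qed.

Lemma ncderiv_dsum (p : ncpoly R g) X Y H K :
  ncderiv p (dsum X Y) (dsum H K) = sqdiag (ncderiv p X H) (ncderiv p Y K).
Proof.
by rewrite !ncderivE -sqdiag_sum; apply: eq_bigr => w _; rewrite dwmx_dsum.
Qed.

Lemma full_rank_dsum (p : ncpoly R g) X Y v w :
  full_rank p X v -> full_rank p Y w -> full_rank p (dsum X Y) (sqcol v w).
Proof.
move=> rkX rkY z; have [z1 [z2 ->]] := sqcolP z.
have [H symH Hz] := rkX z1; have [K symK Kz] := rkY z2.
exists (dsum H K); first exact: symtuple_dsum.
by rewrite ncderiv_dsum sqdiag_col Hz Kz.
Qed.

(** Positive definiteness of the values of the polynomials in [Q] passes to block-diagonal matrices,
    and the same [Q] serves all sizes. *)
Lemma full_rank_set_dsum (p : ncpoly R g)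
    (O : forall k : nat, set (mxtuple R g k)) X Y v w :
  algebraically_open O ->
  full_rank_set p O n (X, v) -> full_rank_set p O m (Y, w) ->
  full_rank_set p O (n + m.+1) (dsum X Y, sqcol v w).
Proof.
move=> [Q _ OE] [/= [/= symX pXv] OX rkX] [/= [/= symY pYw] OY rkY].
split=> /=; last exact: full_rank_dsum.
- split=> /=; first exact: symtuple_dsum.
  by rewrite nceval_dsum sqdiag_col pXv pYw; apply/eqP; rewrite sqcol_eq0 !eqxx.
- move: OX OY; rewrite !OE => -[_ pdX] [_ pdY].
  split=> [|q qQ]; first exact: symtuple_dsum.
  by rewrite nceval_dsum; apply: pdmx_sqdiag; [exact: pdX|exact: pdY].
Qed.

End DirectSum.

(** * Linear independence of word vectors and interpolation *)

Section WordMatrix.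
Variables (R : realType) (g : nat).

(** Rows are indexed by the words of length at most [e], so [row_free] expresses linear independence
    of the vectors [w(X) v]. *)
Definition wordmx e n (X : mxtuple R g n) (v : 'cV[R]_n.+1) :=
  \matrix_(i < #|{: e.-bseq 'I_g}|, k < n.+1) (wmx X (enum_val i) *m v) k 0.

Lemma wordmx_dsum e n m (X : mxtuple R g n) (Y : mxtuple R g m)
    (v : 'cV[R]_n.+1) (w : 'cV[R]_m.+1) :
  wordmx e (dsum X Y) (sqcol v w) =
  row_mx (wordmx e X v) (wordmx e Y w).
Proof.
apply/matrixP => i k; rewrite mxE wmx_dsum sqdiag_col /sqcol.
case: (@split_ordP n.+1 m.+1 k) => j ->.
  by rewrite (@col_mxEu R n.+1 m.+1) [RHS](@row_mxEl R _ n.+1 m.+1) [RHS]mxE.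
by rewrite (@col_mxEd R n.+1 m.+1) [RHS](@row_mxEr R _ n.+1 m.+1) [RHS]mxE.
Qed.

Definition rowpoly e (y : 'rV[R]_#|{: e.-bseq 'I_g}|) : ncpoly R g :=
  \sum_i << y 0 i *g FMonom (enum_val i : e.-bseq 'I_g) >>.

(** Identifies left kernel vectors of [wordmx e X v] with polynomials of degree at most [e] that
    annihilate [v] at [X]. *)
Lemma nceval_rowpoly e (y : 'rV[R]_#|{: e.-bseq 'I_g}|) n
    (X : mxtuple R g n) v :
  nceval (rowpoly y) X *m v = (y *m wordmx e X v)^T.
Proof.
rewrite /nceval raddf_sum /= mulmx_suml; apply/matrixP => k j.
rewrite ord1 !mxE summxE; apply: eq_bigr => i _.
by rewrite mmapU -mulmxE mul_scalar_mx -scalemxAl [LHS]mxE !mxE.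
Qed.

Lemma rowpoly_eq0 e (y : 'rV[R]_#|{: e.-bseq 'I_g}|) :
  (rowpoly y == 0) = (y == 0).
Proof.
apply/eqP/eqP => [y0|->]; last first.
  by rewrite /rowpoly big1 // => i _; rewrite mxE monalgU0.
apply/matrixP => i j; rewrite ord1 mxE.
have := congr1 (mcoeff (FMonom (enum_val j : e.-bseq 'I_g))) y0.
rewrite mcoeff0 raddf_sum /= (bigD1 j) //= mcoeffUU big1 ?addr0 // => k kj.
rewrite mcoeffU; case: eqP => // -[] /val_inj /enum_val_inj kj'.
by rewrite kj' eqxx in kj.
Qed.

Lemma ncdeg_rowpoly e (y : 'rV[R]_#|{: e.-bseq 'I_g}|) :
  (ncdeg (rowpoly y) <= e)%N.
Proof.
suff : (mmeasure (@fdeg 'I_g) (rowpoly y) <= e.+1)%N by rewrite /ncdeg; lia.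
apply: leq_trans (mmeasure_sum _ _ _ _) _.
apply/bigmax_leqP => i _; rewrite mmeasureE msuppU.
case: eqP => _; rewrite ?big_seq_fset0 // big_seq_fset1 ltnS.
exact: size_bseq.
Qed.

(** A relation among the rows is a nonzero polynomial of degree below [ncdeg p], so by minimality it
    fails at some point of the set. Adding that point as a direct summand strictly raises the rank,
    until all rows are independent. *)
Lemma row_free_wordmx (p : ncpoly R g)
    (O : forall n : nat, set (mxtuple R g n)) e :
    algebraically_open O -> zero_min_degree_defining p (full_rank_set p O) ->
    (e < ncdeg p)%N ->
  exists n (X : mxtuple R g n) (v : 'cV[R]_n.+1),
    full_rank_set p O n (X, v) /\ row_free (wordmx e X v).
Proof.
move=> Oopen [_ [n0 [[X0 v0] S0]] mindeg] ep.
suff rankS k : (k <= #|{: e.-bseq 'I_g}|)%N ->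
    exists n (X : mxtuple R g n) (v : 'cV[R]_n.+1),
      full_rank_set p O n (X, v) /\ (k <= \rank (wordmx e X v))%N.
  have [n [X [v [SXv rk]]]] := rankS _ (leqnn _).
  by exists n, X, v; split=> //; rewrite /row_free eqn_leq rank_leq_row.
elim: k => [|k IHk] kN; first by exists n0, X0, v0.
have [n [X [v [SXv rk]]]] := IHk (ltnW kN).
have [rkk|rkk] := ltnP k (\rank (wordmx e X v)); first by exists n, X, v.
have : kermx (wordmx e X v) != 0.
  by rewrite kermx_eq0 /row_free neq_ltn (leq_ltn_trans rkk).
case/rowV0Pn => y /sub_kermxP yX y0.
have [m [Y [w [SYw Yw]]]] : exists m (Y : mxtuple R g m) (w : 'cV[R]_m.+1),
    full_rank_set p O m (Y, w) /\ y *m wordmx e Y w != 0.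
  apply: contrapT => noY; suff: (ncdeg p <= ncdeg (rowpoly y))%N.
    by have := ncdeg_rowpoly y; lia.
  apply: mindeg => [|m Y w SYw]; first by rewrite rowpoly_eq0.
  rewrite nceval_rowpoly; apply: contrapT => /eqP yY; apply: noY.
  exists m, Y, w; split=> //; apply: contraNneq yY => ->.
  by rewrite trmx0.
exists (n + m.+1)%N, (dsum X Y), (sqcol v w).
split; first exact: full_rank_set_dsum.
rewrite wordmx_dsum.
(* The rank grows as soon as the left kernel shrinks strictly; [y] is the vector that drops out. *)
suff : (kermx (row_mx (wordmx e X v) (wordmx e Y w)) < kermx (wordmx e X v))%MS.
  move/rank_ltmx; rewrite !mxrank_ker.
  by rewrite ltn_sub2lE ?rank_leq_row //; exact: leq_ltn_trans.
rewrite ltmxE; apply/andP; split.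
  apply/sub_kermxP.
  have /eqP := mulmx_ker (row_mx (wordmx e X v) (wordmx e Y w)).
  by rewrite mul_mx_row row_mx_eq0 => /andP[/eqP].
apply: contra Yw => kerXY.
have /sub_kermxP/eqP : (y <= kermx (row_mx (wordmx e X v) (wordmx e Y w)))%MS.
  by apply: submx_trans kerXY; apply/sub_kermxP.
by rewrite mul_mx_row row_mx_eq0 => /andP[_].
Qed.

(** Row freeness makes [pinvmx] a right inverse of [wordmx], which solves for each [Z j] separately.
    The [Z j] need not be symmetric. *)
Lemma wordmx_interpolation e n (X : mxtuple R g n) (v : 'cV[R]_n.+1)
    (Y : 'I_g -> seq 'I_g -> 'cV[R]_n.+1) :
  row_free (wordmx e X v) ->
  exists Z : mxtuple R g n, forall j u, (size u <= e)%N ->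
    Z j *m (wmx X u *m v) = Y j u.
Proof.
move=> /mulmxVp free.
pose M j := \matrix_(i < #|{: e.-bseq 'I_g}|, k < n.+1) Y j (enum_val i) k 0.
exists (fun j => (pinvmx (wordmx e X v) *m M j)^T) => j u ue.
pose i := enum_rank (Bseq ue).
have rowX : row i (wordmx e X v) = (wmx X u *m v)^T.
  by apply/matrixP => a b; rewrite !mxE enum_rankK ord1.
rewrite -[wmx X u *m v]trmxK -rowX -trmx_mul -row_mul mulmxA free mul1mx.
by apply/matrixP => a b; rewrite !mxE enum_rankK ord1.
Qed.

End WordMatrix.

(** * Coefficients, degree and symmetry of nc polynomials *)

Section Polynomial.
Variables (R : realType) (g : nat).
Implicit Types (p : ncpoly R g).

Lemma size_msupp p (w : {fmonom 'I_g}) :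
  w \in msupp p -> (size w <= ncdeg p)%N.
Proof.
move=> wp; have : (size w < mmeasure (@fdeg 'I_g) p)%N := mmeasure_mnm_lt _ wp.
by rewrite /ncdeg; lia.
Qed.

(** Positivity of the degree excludes [p = 0], which has degree 0 but empty support. *)
Lemma ex_word_ncdeg p : (0 < ncdeg p)%N ->
  exists2 w : {fmonom 'I_g}, w \in msupp p & size w = ncdeg p.
Proof.
move=> p0; apply: contrapT => nop.
suff : (mmeasure (@fdeg 'I_g) p <= ncdeg p)%N by move: p0; rewrite /ncdeg; lia.
rewrite mmeasureE big_seq; apply/bigmax_leqP_seq => w _ wp.
rewrite ltn_neqAle size_msupp // andbT.
by apply/eqP => wd; apply: nop; exists w.
Qed.

Lemma sum_msupp_pick p (V : lmodType R) (x : V) (u : seq 'I_g) :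
  \sum_(w <- msupp p) p@_w *: (if w == u :> seq _ then x else 0) =
  p@_(FMonom u) *: x.
Proof.
have pick w : p@_w *: (if w == u :> seq _ then x else 0) =
    if w == FMonom u then p@_(FMonom u) *: x else 0.
  rewrite -(inj_eq val_inj) /=; case: eqP => [<-|_]; last exact: scaler0.
  by case: w.
rewrite (eq_bigr _ (fun w _ => pick w)) -big_mkcond /=.
have [up|up] := boolP (FMonom u \in msupp p); last first.
  rewrite (mcoeff_outdom up) scale0r big1_seq // => w /andP[/eqP -> //].
rewrite (big_rem (FMonom u)) //= eqxx big1_seq ?addr0 // => w /andP[/eqP ->].
by rewrite (mem_rem_uniq _ (fset_uniq _)) inE eqxx.
Qed.

Lemma mcoeff_rev p (w : {fmonom 'I_g}) : ncsymmetric p ->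
  p@_(FMonom (rev w)) = p@_w.
Proof.
move=> p_sym; rewrite -{1}p_sym /nctr raddf_sum /=.
(* Viewing scalars as vectors of the module [R^o] makes [sum_msupp_pick] applicable. *)
transitivity (p@_(FMonom w) *: (1 : R^o)); last first.
  by rewrite [LHS]mulr1; case: w.
rewrite -sum_msupp_pick; apply: eq_bigr => u _; rewrite mcoeffU.
rewrite -(inj_eq val_inj) /= (can_eq revK).
by case: eqP => _; rewrite ?scaler0 // [RHS]mulr1.
Qed.

Lemma tr_wmx n (X : mxtuple R g n) w : symtuple X ->
  (wmx X w)^T = wmx X (rev w).
Proof.
move=> symX; elim: w => [|i w IHw]; first by rewrite !wmx_nil trmx1.
rewrite wmx_cons trmx_mul IHw rev_cons (elimT (symmetricmxP _) (symX i)).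
by rewrite /wmx -cats1 big_cat big_seq1.
Qed.

Lemma nceval_sym p n (X : mxtuple R g n) : ncsymmetric p -> symtuple X ->
  nceval p X \is symmetricmx.
Proof.
move=> p_sym symX; apply/symmetricmxP; rewrite -[in RHS]p_sym /nctr.
rewrite [RHS](raddf_sum (mmap _ _)) /= ncevalE raddf_sum /=.
apply: eq_bigr => w _; rewrite mmapU linearZ /= tr_wmx //.
by rewrite -mul_scalar_mx.
Qed.

End Polynomial.

(** * Positive curvature at the doubled point *)

Section Curvature.
Variables (R : realType) (g : nat).

(** The vectors [y (+) -y] form a subspace invariant under [X (+) X]. *)
Lemma border_double n (X : mxtuple R g n) Y w :
  border (dsum X X) (fun j u => sqcol (Y j u) (- Y j u)) w =
  sqcol (border X Y w) (- border X Y w).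
Proof.
elim: w => [|i w IHw] /=.
  by symmetry; apply/eqP; rewrite oppr0 sqcol_eq0 !eqxx.
by rewrite IHw sqdiag_col sqcolD mulmxN opprD.
Qed.

(** The signs cancel in the inner products, so the two blocks contribute equally. *)
Lemma hess_double n (X : mxtuple R g n) Y b w :
  let YY := fun j u => sqcol (Y j u) (- Y j u) in
  hess (dsum X X) YY YY b w = 2 * hess X Y Y b w.
Proof.
elim: w b => [|i w IHw] b /=; first by rewrite mulr0.
rewrite IHw border_double inner_sqcol innerNl innerNr opprK.
ring.
Qed.

(* On [X (+) X] with vector [v (+) v] the directions [H] can be chosen so that
   [H_j u(X (+) X) (v (+) v) = Y j u (+) - Y j u] for an arbitrary [Y]: the
   compatibility [<Y j u, w v> = <u v, Y j w>] required by the symmetry of [H_j]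
   holds because both sides vanish. *)
Lemma hess_sum_le0 (p : ncpoly R g) (O : forall n : nat, set (mxtuple R g n))
    n (X : mxtuple R g n) v Y :
    algebraically_open O ->
    (forall k (Z : mxtuple R g k) z,
       full_rank_set p O k (Z, z) -> positive_curvature p Z z) ->
    full_rank_set p O n (X, v) -> (0 < ncdeg p)%N ->
    row_free (wordmx (ncdeg p).-1 X v) ->
  \sum_(w <- msupp p) p@_w * hess X Y Y [::] w <= 0.
Proof.
move=> O_open curvature SXv d0 free; set d := ncdeg p in d0 free *.
have [[w0] w0p w0d] := ex_word_ncdeg d0.
case: w0 => [|k c] /= in w0p w0d; first by move: d0; rewrite /d -w0d.
have pkc : p@_(FMonom (k :: c)) != 0 by rewrite mcoeff_neq0.
(* Placed at the letter [k] and the word [c], this value adds exactly minus the given sum to the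
   first derivative, through the top word [k :: c]. *)
pose a := - (p@_(FMonom (k :: c)))^-1 *:
  \sum_(w <- msupp p) p@_w *: border X Y w.
pose Y' j u := Y j u + single k c a j u.
have cd : size c = d.-1 by rewrite /d -w0d.
(* [Y'] solves [p'(X)[H]v = 0] through words of length [d - 1], which [p''] does
   not involve. *)
have border_sum0 : \sum_(w <- msupp p) p@_w *: border X Y' w = 0.
  under eq_bigr do rewrite borderD scalerDr.
  rewrite big_split /=.
  have -> : \sum_(w <- msupp p) p@_w *: border X (single k c a) w =
      p@_(FMonom (k :: c)) *: a.
    rewrite -sum_msupp_pick; apply: eq_big_seq => w /size_msupp wd.
    by rewrite border_single // cd prednK.
  by rewrite scalerA mulrN divff // scaleN1r addrN.
have -> : \sum_(w <- msupp p) p@_w * hess X Y Y [::] w =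
    \sum_(w <- msupp p) p@_w * hess X Y' Y' [::] w.
  apply: eq_big_seq => w /size_msupp wd; congr (_ * _).
  apply: (@eq_hess _ _ _ _ _ _ d.-1) => [j u ud|]; last by rewrite prednK.
  rewrite /Y' /single; case: (u =P c) => [uc|]; rewrite ?andbF ?addr0 //.
  by rewrite uc cd ltnn in ud.
have [Z ZY] := wordmx_interpolation Y' free.
(* The diagonal blocks are symmetric and the off-diagonal ones transposes of each other, so [H j] is
   symmetric. Its block rows sum to [Z j] and [- Z j], so it sends [x (+) x] to
   [Z j x (+) - Z j x]. *)
pose H : mxtuple R g (n + n.+1) := fun j => 2^-1 *: sqblock
  (Z j + (Z j)^T) (Z j - (Z j)^T) ((Z j)^T - Z j) (- (Z j + (Z j)^T)).
pose YY j u : 'cV[R]_((n + n.+1).+1) := sqcol (Y' j u) (- Y' j u).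
have symH : symtuple H.
  move=> j; apply/symmetricmxP; rewrite linearZ /= tr_sqblock; congr (_ *: _).
  by congr sqblock; rewrite !(linearN, linearD) /= trmxK // addrC.
have SXX := full_rank_set_dsum O_open SXv SXv.
have HYY j u : (size u < d)%N ->
    H j *m (wmx (dsum X X) u *m sqcol v v) = YY j u.
  move=> ud; rewrite wmx_dsum sqdiag_col -scalemxAl sqblock_col.
  rewrite /YY -(ZY j u); last by lia.
  set x := wmx X u *m v.
  have ul : Z j + (Z j)^T + (Z j - (Z j)^T) = 2 *: Z j.
    by rewrite addrACA subrr addr0 scaler_nat.
  have dl : (Z j)^T - Z j - (Z j + (Z j)^T) = - (2 *: Z j).
    by rewrite -ul [RHS]opprD opprB [RHS]addrC.
  rewrite -!mulmxDl ul dl mulNmx -!scalemxAl sqcolZ scalerN.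
  by rewrite scalerA mulVf ?pnatr_eq0 // scale1r.
have dE : ncderiv p (dsum X X) H *m sqcol v v = 0.
  rewrite ncderivE mulmx_suml.
  transitivity (\sum_(w <- msupp p) p@_w *:
      sqcol (border X Y' w) (- border X Y' w)).
    apply: eq_big_seq => w /size_msupp wd.
    by rewrite -scalemxAl (dwmx_border HYY wd) border_double.
  rewrite sqcol_sum (eq_bigr _ (fun w _ => scalerN _ _)) sumrN border_sum0.
  by apply/eqP; rewrite sqcol_eq0 oppr0 !eqxx.
have := curvature _ _ _ SXX H symH dE.
rewrite ncderiv2E -scalemxAl innerZl mulmx_suml inner_suml.
have symXX : symtuple (dsum X X) by apply: symtuple_dsum; case: SXv => -[].
have -> : \sum_(w <- msupp p)
    inner (p@_w *: ddwmx (dsum X X) H w *m sqcol v v) (sqcol v v) =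
    2 * \sum_(w <- msupp p) p@_w * hess X Y' Y' [::] w.
  rewrite mulr_sumr; apply: eq_big_seq => w /size_msupp wd.
  rewrite -scalemxAl innerZl.
  have := ddwmx_hess (b := [::]) (w := w) symXX symH HYY wd.
  rewrite wmx_nil mul1mx => ->; rewrite hess_double; ring.
(* Of the two factors 2 in the curvature inequality, one comes from the second derivative and one
   from the two blocks. *)
lra.
Qed.

End Curvature.

(** * Degree bound and concavity *)

Section Conclusion.
Variables (R : realType) (g : nat) (p : ncpoly R g).

(** Tested on [a A + B], with [A] and [B] single border vectors cut from a longest word [j i c], [c]
    nonempty, the sum is affine in [a]. Its slope [2 p0 <x, x>] is nonzero, the word and its reverse
    both having coefficient [p0], so the sum is unbounded above. *)
Lemma ncdeg_le2 n (X : mxtuple R g n) :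
    ncsymmetric p ->
    (forall Y, \sum_(w <- msupp p) p@_w * hess X Y Y [::] w <= 0) ->
  (ncdeg p <= 2)%N.
Proof.
move=> p_sym hess_le0; rewrite leqNgt; apply/negP => d3.
have [[w0] w0p w0d] := ex_word_ncdeg (ltn_trans (isT : 0 < 2)%N d3).
case: w0 => [|j [|i c]] /= in w0p w0d; [by rewrite -w0d in d3..|].
have c0 : (0 < size c)%N by move: d3; rewrite -w0d.
pose x : 'cV[R]_n.+1 := const_mx 1.
have x0 : 0 < inner x x by exact: inner_const1_gt0.
set p0 := p@_(FMonom [:: j, i & c]).
have p0_neq0 : p0 != 0 by rewrite mcoeff_neq0.
pose A := single i c x; pose B := single j [::] x.
pose q := \sum_(w <- msupp p) p@_w * hess X B B [::] w.
have sumE a : \sum_(w <- msupp p) p@_w * hess X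
    (fun k u => a *: A k u + B k u) (fun k u => a *: A k u + B k u) [::] w =
    a * (2 * p0 * inner x x) + q.
  have pick (u : seq 'I_g) : \sum_(w <- msupp p)
      p@_w * ((w == u :> seq _)%:R * inner x x) = p@_(FMonom u) * inner x x.
    rewrite -[RHS](sum_msupp_pick p (inner x x : R^o)); apply: eq_bigr => w _.
    by case: eqP => _; rewrite ?mul1r // mul0r scaler0 mulr0.
  have rev_p0 : p@_(FMonom (rev [:: j, i & c])) = p0.
    exact: (mcoeff_rev (FMonom [:: j, i & c]) p_sym).
  have -> : a * (2 * p0 * inner x x) =
      a * (p0 * inner x x + p@_(FMonom (rev [:: j, i & c])) * inner x x).
    by rewrite rev_p0; ring.
  rewrite -!pick -big_split /= mulr_sumr -big_split /=.
  apply: eq_big_seq => w /size_msupp wd; rewrite -w0d in wd.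
  have [AA AB BA] := hess_singles X i j x c0 wd.
  by rewrite hess_quadratic AA AB BA; ring.
(* This value of [a] makes the sum equal to 1. *)
have := hess_le0 (fun k u => ((1 - q) / (2 * p0 * inner x x)) *: A k u + B k u).
rewrite sumE divfK; first by rewrite subrK ler10.
by rewrite !mulf_neq0 ?pnatr_eq0 // gt_eqF.
Qed.

(** Weighted by the coefficients of [p] and summed, this is the quadratic form at [b] of the matrix
    of coefficients of the words [x_i x_j]. *)
Definition quadword (b : 'I_g -> R) (w : seq 'I_g) : R :=
  if w is [:: i; j] then b i * b j else 0.

Lemma hess_quadword n (X : mxtuple R g n) (b : 'I_g -> R) x w :
    (size w <= 2)%N ->
  hess X (fun j _ => b j *: x) (fun j _ => b j *: x) [::] w =
  quadword b w * inner x x.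
Proof.
case: w => [|i [|j [|//]]] _ /=; rewrite ?mul0r // inner0l ?addr0 //.
by rewrite mulmx0 !addr0 innerZl innerZr; ring.
Qed.

(** Constant and linear terms cancel in the convexity defect of [- p], leaving [- t (1 - t)] times
    the quadratic part of [p] at [X - Y]. *)
Lemma ncconcave_deg2 : ncsymmetric p -> (ncdeg p <= 2)%N ->
    (forall b, \sum_(w <- msupp p) p@_w * quadword b w <= 0) ->
  ncconcave p.
Proof.
move=> p_sym p2 quad_le0 n X Y t symX symY /andP[t0 t1].
set XY : mxtuple R g n := fun i => t *: X i + (1 - t) *: Y i.
have symXY : symtuple XY.
  move=> i; apply/symmetricmxP; rewrite linearD !linearZ /=.
  rewrite (elimT (symmetricmxP _) (symX i)).
  by rewrite (elimT (symmetricmxP _) (symY i)).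
have evalN Z : nceval (- p) Z = - nceval p Z :> 'M_n.+1 by exact: mmapN.
rewrite !evalN; split.
  apply/symmetricmxP; rewrite !(linearD, linearN, linearZ) /=.
  by rewrite !(elimT (symmetricmxP _) (nceval_sym p_sym _)).
move=> v; pose D i := X i - Y i.
pose q (w : seq 'I_g) := if w is [:: i; j] then D i *m D j else 0.
have -> : t *: - nceval p X + (1 - t) *: - nceval p Y - - nceval p XY =
    - (t * (1 - t)) *: \sum_(w <- msupp p) p@_w *: q w.
  rewrite !ncevalE !scalerN opprK !scaler_sumr -!sumrN -!big_split /=.
  apply: eq_big_seq => w /size_msupp; move/leq_trans => /(_ _ p2).
  move: (p@_w); case: w => -[|i [|j [|//]]] /= a _.
  - by rewrite !wmx_nil; apply/matrixP => k l; rewrite !mxE; ring.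
  - rewrite !wmx_cons !wmx_nil !mulmx1.
    by apply/matrixP => k l; rewrite !mxE; ring.
  - rewrite !wmx_cons !wmx_nil !mulmx1 /XY /D.
    rewrite !(mulmxDl, mulmxDr, mulNmx, mulmxN) -!scalemxAl -!scalemxAr.
    (* Once the four products are opaque, the identity is linear in their entries. *)
    move: (X i *m X j) (X i *m Y j) (Y i *m X j) (Y i *m Y j) => XX xy yx YY.
    by apply/matrixP => k l; rewrite !mxE; ring.
rewrite -scalemxAl innerZl mulmx_suml inner_suml.
(* Symmetry of [D i] turns [<D i D j v, v>] into [<D j v, D i v>]; each coordinate [k] then gives
   the scalar form at [b_i = (D i v)_k]. *)
have -> : \sum_(w <- msupp p) inner (p@_w *: q w *m v) v =
    \sum_k \sum_(w <- msupp p) p@_w * quadword (fun i => (D i *m v) k 0) w.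
  rewrite exchange_big /=; apply: eq_bigr => w _.
  rewrite -scalemxAl innerZl -mulr_sumr; congr (_ * _).
  case: w => -[|i [|j [|k u]]] /=; rewrite ?mul0mx ?inner0l;
    try by rewrite big1.
  rewrite -mulmxA inner_mulmx linearB /=.
  rewrite (elimT (symmetricmxP _) (symX i)) (elimT (symmetricmxP _) (symY i)).
  by rewrite innerC innerE.
rewrite mulNr oppr_ge0 mulr_ge0_le0 ?mulr_ge0 ?subr_ge0 //.
by apply: sumr_le0.
Qed.

End Conclusion.

Local Open Scope classical_set_scope.

Theorem corollary1p3 (R : realType) (g : nat) (p : ncpoly R g)
    (O : forall n : nat, set (mxtuple R g n))
    (p_sym : ncsymmetric p)
    (O_open : algebraically_open O)
    (scalar_point : full_rank_set p O 0%N !=set0)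
    (curvature : forall (n : nat) (X : mxtuple R g n) (v : 'cV[R]_n.+1),
        full_rank_set p O n (X, v) -> positive_curvature p X v)
    (min_degree : zero_min_degree_defining p (full_rank_set p O)) :
  (ncdeg p <= 2)%N /\ ncconcave p.
Proof.
(* Degree 0 is separate because [(ncdeg p).-1] truncates there; the quadratic form is then zero. *)
have [d0|d0] := posnP (ncdeg p).
  have p2 : (ncdeg p <= 2)%N by rewrite d0.
  split=> //; apply: ncconcave_deg2 => // b.
  rewrite big1_seq // => -[[|i u]] /andP[_ /size_msupp]; last by rewrite d0.
  by rewrite mulr0.
have [|n [X [v [SXv free]]]] := row_free_wordmx (e := (ncdeg p).-1) O_open
  min_degree; first by rewrite prednK.
have hess_le0 Y := hess_sum_le0 Y O_open curvature SXv d0 free.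
have p2 := ncdeg_le2 p_sym hess_le0.
split=> //; apply: ncconcave_deg2 => // b.
pose x : 'cV[R]_n.+1 := const_mx 1.
have x0 : 0 < inner x x by exact: inner_const1_gt0.
(* A family depending on the letter alone reduces the sum to the quadratic form at [b] times
   [inner x x], which is positive. *)
have := hess_le0 (fun j _ => b j *: x).
rewrite (_ : \sum_(w <- _) _ =
  (\sum_(w <- msupp p) p@_w * quadword b w) * inner x x).
  by rewrite pmulr_lle0.
rewrite mulr_suml; apply: eq_big_seq => w /size_msupp wd.
by rewrite hess_quadword ?mulrA //; exact: leq_trans wd p2.
Qed.
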